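(* Let $K$ be a field, $P=K[x_1,\dots,x_n]$, and let $\sigma$ be a term ordering on $\mathbb T^n=\mathbb T(x_1,\dots,x_n)$ with $x_1>_\sigma\cdots>_\sigma x_n$. Let $i\in\{1,\dots,n\}$, let $c_{i+1},\dots,c_n,\gamma\in K$, and let $L=x_i-\ell$, where $\ell=\sum_{j>i}c_jx_j+\gamma$ if $i<n$ and $\ell=\gamma$ if $i=n$. Let $\hat P=K[x_1,\dots,x_{i-1},x_{i+1},\dots,x_n]$ and let $\pi_L:P\to\hat P$ be the $K$-algebra homomorphism with $\pi_L(x_i)=\ell$ and $\pi_L(x_j)=x_j$ for $j\neq i$. Let $\hat\sigma$ be the restriction of $\sigma$ to $\mathbb T(x_1,\dots,x_{i-1},x_{i+1},\dots,x_n)$. Let $I$ be an ideal of $P$, let $G=\{g_1,\dots,g_s\}$ be a monic $\sigma$-Gröbner basis of $I$, and assume that $\mathrm{LT}_\sigma(g_j)=\mathrm{LT}_{\hat\sigma}(\pi_L(g_j))$ for every $j=1,\dots,s$. Then: (a) The linear polynomial $L$ does not divide zero modulo $I$. (b) The set $\pi_L(G)=\{\pi_L(g_1),\dots,\pi_L(g_s)\}$ is a $\hat\sigma$-Gröbner basis of $\pi_L(I)$. (c) If $G$ is minimal, then also $\pi_L(G)$ is minimal. (d) If $L=x_i-\gamma$ and $G$ is the reduced $\sigma$-Gröbner basis of $I$, then $\pi_L(G)$ is the reduced $\hat\sigma$-Gröbner basis of $\pi_L(I)$.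
   Context: $\mathbb T(\dots)$ denotes the monoid of power products (terms, without coefficients) in the listed indeterminates; a term ordering is a multiplicative total ordering with $1$ as smallest element. For a nonzero polynomial $f$, $\mathrm{LT}_\sigma(f)$ is the $\sigma$-largest power product in the support of $f$ (without coefficient). ''Monic'' means that every element has leading coefficient $1$. ''$L$ does not divide zero modulo $I$'' means that $FL\in I$ with $F\in P$ implies $F\in I$. A Gröbner basis is minimal if the leading terms of its elements form a minimal system of generators of the leading term ideal; it is reduced if moreover its elements are monic and no power product in the support of $g_j-\mathrm{LT}(g_j)$ is divisible by the leading term of any element of the basis, for every $j$. The quotient $P/(L)$ is identified with $\hat P$ via $\pi_L$. *)

(* Defs.v *)
From HB Require Import structures.
From mathcomp Require Import all_boot all_order all_algebra.
From mathcomp Require Export finmap mpoly.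

Set Implicit Arguments.
Unset Strict Implicit.
Unset Printing Implicit Defensive.

Import GRing.Theory.
Local Open Scope ring_scope.

Section TermOrderings.

(* [sigma s t] is the non-strict comparison "s <= t". *)
Definition term_ordering n (sigma : rel 'X_{1..n}) : Prop :=
  [/\ total sigma, antisymmetric sigma, transitive sigma,
      forall s t u : 'X_{1..n}, sigma s t -> sigma (s + u)%MM (t + u)%MM
    & forall t : 'X_{1..n}, sigma 0%MM t].

Definition slt n (sigma : rel 'X_{1..n}) (s t : 'X_{1..n}) : bool :=
  (s != t) && sigma s t.

(* The inclusion of the power products in the indeterminates other than the
   i-th one: the k-th indeterminate of the smaller ring is the [lift i k]-th
   indeterminate of the larger one. *)
Definition emb n (i : 'I_n.+1) (t : 'X_{1..n}) : 'X_{1..n.+1} :=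
  [multinom (if unlift i j is Some k then t k else 0%N) | j < n.+1].

Definition hat_ordering n (i : 'I_n.+1) (sigma : rel 'X_{1..n.+1}) :
    rel 'X_{1..n} :=
  fun s t => sigma (emb i s) (emb i t).

End TermOrderings.

Section LeadingTerms.

Variables (K : fieldType) (n : nat) (sigma : rel 'X_{1..n}).
Implicit Types (f g : {mpoly K[n]}) (G : {fset {mpoly K[n]}}).

(* The sigma-largest element of the support of f; junk value 0%MM, i.e. the
   power product 1, when f = 0. *)
Definition LT f : 'X_{1..n} :=
  foldr (fun s t => if sigma s t then t else s) 0%MM (msupp f).

Definition LC f : K := f@_(LT f).

(* Ring_quotient's [idealr] only covers proper ideals with a boolean membership
   test, hence this definition. *)
Definition is_ideal (I : {mpoly K[n]} -> Prop) : Prop :=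
  [/\ I 0, forall f g, I f -> I g -> I (f + g)
    & forall a f, I f -> I (a * f)].

Definition ideal_gen (S : {mpoly K[n]} -> Prop) : {mpoly K[n]} -> Prop :=
  fun f => forall J, is_ideal J -> (forall g, S g -> J g) -> J f.

Definition LT_ideal (I : {mpoly K[n]} -> Prop) : {mpoly K[n]} -> Prop :=
  ideal_gen (fun t => exists f, [/\ I f, f != 0 & t = 'X_[LT f]]).

Definition LTs_generate G (I : {mpoly K[n]} -> Prop) : Prop :=
  forall f, ideal_gen (fun t => exists2 g, g \in G & t = 'X_[LT g]) f
            <-> LT_ideal I f.

Definition groebner_basis G (I : {mpoly K[n]} -> Prop) : Prop :=
  (forall g, g \in G -> I g /\ g != 0) /\ LTs_generate G I.

Definition monic_set G : Prop := forall g, g \in G -> LC g = 1.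

Definition minimal_groebner_basis G (I : {mpoly K[n]} -> Prop) : Prop :=
  groebner_basis G I /\
  forall g, g \in G -> ~ LTs_generate (G `\ g)%fset I.

Definition reduced_groebner_basis G (I : {mpoly K[n]} -> Prop) : Prop :=
  [/\ minimal_groebner_basis G I, monic_set G
    & forall g h t, g \in G -> h \in G ->
        t \in msupp (g - 'X_[LT g]) -> ~~ (LT h <= t)%MM].

End LeadingTerms.

Section LinearSection.

Variables (K : fieldType) (n : nat) (i : 'I_n.+1).
Variables (c : 'I_n.+1 -> K) (gamma : K).

(* Only the values [c j] with i < j are used; for i the last index the sum is
   empty. *)
Definition linL : {mpoly K[n.+1]} :=
  'X_i - (\sum_(j < n.+1 | (i < j)%N) c j *: 'X_j + gamma%:MP).

(* The same linear form, in the ring without the i-th indeterminate. *)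
Definition ell_hat : {mpoly K[n]} :=
  \sum_(k < n | (i < lift i k)%N) c (lift i k) *: 'X_k + gamma%:MP.

Definition piL (f : {mpoly K[n.+1]}) : {mpoly K[n]} :=
  f \mPo [tuple (if unlift i j is Some k then 'X_k else ell_hat) | j < n.+1].

Definition piL_ideal (I : {mpoly K[n.+1]} -> Prop) : {mpoly K[n]} -> Prop :=
  fun h => exists2 f, I f & h = piL f.

Definition piL_set (G : {fset {mpoly K[n.+1]}}) : {fset {mpoly K[n]}} :=
  [fset piL g | g in G]%fset.

End LinearSection.

(* Main.v *)
(* Every LT(g_j) is free of x_i and LT(L) = x_i, so LT(f L) = LT(f) x_i is
   divisible by some LT(g_j) only if LT(f) is. Hence, if f L is in I, reducing f
   by G keeps f L in I, and well-founded induction on LT(f) gives f in I. For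
   (b), an element f of I whose leading term involves x_i can be reduced by a
   multiple of some g_j L without changing its image pi_L(f); when LT(f) is free
   of x_i, substitution preserves the leading term, which is therefore divisible
   by some LT(g_j) = LT(pi_L(g_j)). Parts (c) and (d) are comparisons of leading
   terms and supports. *)

Require Import Defs.
From mathcomp Require Import all_boot all_order all_algebra.
From Stdlib Require Import Classical.
Local Open Scope ring_scope.
Import GRing.Theory.
Set Implicit Arguments.
Unset Strict Implicit.
Unset Printing Implicit Defensive.

(* Induction over the coordinates: once B works for the coordinates in A, the
   elements of S it misses for an extra coordinate a lie in one of the finitely
   many slices s a = N with N < max_B (b a). *)
Lemma dickson n (S : 'X_{1..n} -> Prop) :
  exists2 B : seq 'X_{1..n}, (forall b, b \in B -> S b) &
    forall s, S s -> exists2 b, b \in B & (b <= s)%MM.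
Proof.
suff: forall A : seq 'I_n, forall S : 'X_{1..n} -> Prop,
  exists2 B : seq 'X_{1..n}, (forall b, b \in B -> S b) &
    forall s, S s -> exists2 b, b \in B & forall j, j \in A -> (b j <= s j)%N.
  move=> /(_ (enum 'I_n) S) [B BS SB]; exists B => // s /SB[b bB le_bs].
  by exists b => //; apply/mnm_lepP => j; apply: le_bs; rewrite mem_enum.
elim=> [|a A IHA] {}S.
  have [[s Ss]|S0] := classic (exists s, S s).
    by exists [:: s] => [b|t _]; [rewrite inE => /eqP-> | exists s; rewrite ?inE].
  by exists [::] => // s Ss; case: S0; exists s.
have slices N : exists2 B : seq 'X_{1..n}, (forall b, b \in B -> S b) &
    forall s, S s -> (s a < N)%N ->
      exists2 b, b \in B & forall j, j \in a :: A -> (b j <= s j)%N.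
  elim: N => [|N [B BS SB]]; first by exists [::].
  (* On the slice where coordinate [a] equals [N], the comparison at [a] is an equality, so the
     coordinates in [A] suffice. *)
  have [C CS SC] := IHA (fun s => S s /\ s a = N).
  exists (B ++ C) => [b|s Ss].
    by rewrite mem_cat => /orP[/BS|/CS[]].
  rewrite ltnS leq_eqVlt => /orP[/eqP saN|saN].
    have [b bC le_bs] := SC s (conj Ss saN).
    exists b => [|j]; first by rewrite mem_cat bC orbT.
    rewrite inE => /orP[/eqP->|/le_bs //].
    by rewrite saN; case: (CS b bC) => _ ->.
  have [b bB le_bs] := SB s Ss saN.
  by exists b => //; rewrite mem_cat bB.
have [B BS SB] := IHA S.
have [C CS SC] := slices (\max_(b <- B) b a)%N.
exists (B ++ C) => [b|s Ss]; first by rewrite mem_cat => /orP[/BS|/CS].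
have [le_Bs|lt_sB] := leqP (\max_(b <- B) b a) (s a).
  have [b bB le_bs] := SB s Ss; exists b => [|j]; first by rewrite mem_cat bB.
  rewrite inE => /orP[/eqP->|/le_bs //]; apply: leq_trans le_Bs.
  by rewrite (big_rem b) //= leq_maxl.
have [b bC le_bs] := SC s Ss lt_sB.
by exists b => //; rewrite mem_cat bC orbT.
Qed.

(** * Monomial ideals and a divisibility criterion for Gröbner bases *)

Section Ideals.
Variables (n : nat) (K : fieldType) (sigma : rel 'X_{1..n}).
Implicit Types f g p q : {mpoly K[n]}.

(** The polynomials whose support consists of multiples of elements of [T] form an ideal containing
    the generators. Conversely, such a polynomial is the sum of its terms, each a multiple of a
    generator. *)
Lemma ideal_gen_monomialP (T : 'X_{1..n} -> Prop) f :
  ideal_gen (fun p => exists2 t, T t & p = 'X_[t]) f <->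
  forall m, m \in msupp f -> exists2 t, T t & (t <= m)%MM.
Proof.
split=> [gen_f|div_f].
  pose J p := forall m, m \in msupp p -> exists2 t, T t & (t <= m)%MM.
  apply: (gen_f J); last first.
    by move=> _ [t Tt ->] m; rewrite msuppX inE => /eqP->; exists t; rewrite ?lepm_refl.
  split=> [m|p q Jp Jq m|a p Jp m]; first by rewrite msupp0.
    by move/msuppD_le; rewrite mem_cat => /orP[/Jp|/Jq].
  move=> /msuppM_le /allpairsP[[u1 u2] /= [_ /Jp[t Tt le_t] ->]].
  exists t => //; apply: lepm_trans le_t _; apply/mnm_lepP => j.
  by rewrite mnmDE leq_addl.
move=> J [J0 JD JM] genJ; rewrite (mpolyE f) big_seq.
apply: big_ind => // m /div_f [t Tt /submK <-].
by rewrite mpolyXD scalerAl; apply/JM/genJ; exists t.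
Qed.

Lemma is_idealB (I : {mpoly K[n]} -> Prop) f g :
  is_ideal I -> I f -> I g -> I (f - g).
Proof. by case=> _ ID IM If Ig; rewrite -mulN1r; apply: ID => //; apply: IM. Qed.

Lemma ideal_gen_ext (S T : {mpoly K[n]} -> Prop) f :
  (forall p, S p <-> T p) -> ideal_gen S f <-> ideal_gen T f.
Proof. by move=> ST; split=> gen_f J idJ SJ; apply: gen_f => // g /ST; apply: SJ. Qed.

(** Both ideals are monomial, so membership is divisibility in the support. One inclusion follows
    from [G] lying in [I]; the other is tested on the single power products [LT sigma f]. *)
Lemma LTs_generateP (G : {fset {mpoly K[n]}}) (I : {mpoly K[n]} -> Prop) :
    (forall g, g \in G -> I g /\ g != 0) ->
  LTs_generate sigma G I <->
  forall f, I f -> f != 0 ->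
    exists2 g, g \in G & (LT sigma g <= LT sigma f)%MM.
Proof.
move=> GI.
have genS (S : {mpoly K[n]} -> Prop) f :
    ideal_gen (fun p => exists2 g, S g & p = 'X_[LT sigma g]) f <->
    forall m, m \in msupp f -> exists2 g, S g & (LT sigma g <= m)%MM.
  rewrite (@ideal_gen_ext _ (fun p : {mpoly K[n]} => exists2 t,
    (exists2 g, S g & LT sigma g = t) & p = 'X_[t])).
    rewrite ideal_gen_monomialP; split=> div_f m /div_f.
      by case=> _ [g Sg <-]; exists g.
    by case=> g Sg le_g; exists (LT sigma g) => //; exists g.
  move=> p; split=> [[g Sg ->]|[_ [g Sg <-] ->]]; last by exists g.
  by exists (LT sigma g) => //; exists g.
have genG f := genS (fun g => g \in G) f.
have genI f : LT_ideal sigma I f <-> forall m, m \in msupp f ->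
    exists2 g, I g /\ g != 0 & (LT sigma g <= m)%MM.
  rewrite -genS; apply: ideal_gen_ext => p.
  by split=> [[g [Ig g0 ->]]|[g [Ig g0] ->]]; exists g.
split=> [gen f If f0|div f].
  have /gen/genG/(_ (LT sigma f)) : LT_ideal sigma I 'X_[LT sigma f].
    by apply/genI => m; rewrite msuppX inE => /eqP->; exists f; rewrite ?lepm_refl.
  by apply; rewrite msuppX mem_head.
rewrite genG genI; split=> div_m m /div_m [g].
  by move=> /GI gI le_g; exists g.
case=> Ig g0 le_gm; have [h hG le_hg] := div g Ig g0.
by exists h => //; apply: lepm_trans le_hg le_gm.
Qed.

End Ideals.

(** * Term orderings and their well-foundedness *)

Section TermOrdering.
Variables (n : nat) (sigma : rel 'X_{1..n}).
Hypothesis to_sigma : term_ordering sigma.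
Implicit Types s t u v : 'X_{1..n}.

Lemma to_refl s : sigma s s.
Proof. by case: to_sigma => tot _ _ _ _; case/orP: (tot s s). Qed.

Lemma to_trans t s u : sigma s t -> sigma t u -> sigma s u.
Proof. by case: to_sigma => _ _ tr _ _; apply: tr. Qed.

Lemma to_anti s t : sigma s t -> sigma t s -> s = t.
Proof. by case: to_sigma => _ anti _ _ _ st ts; apply: anti; rewrite st. Qed.

Lemma to_0 t : sigma 0%MM t.
Proof. by case: to_sigma. Qed.

Lemma to_add2r u s t : sigma s t -> sigma (s + u)%MM (t + u)%MM.
Proof. by case: to_sigma => _ _ _ + _; apply. Qed.

Lemma to_addm s t u v :
  sigma s t -> sigma u v -> sigma (s + u)%MM (t + v)%MM.
Proof.
move=> st uv; apply: (to_trans (to_add2r u st)).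
by rewrite ![(t + _)%MM]addmC; apply: to_add2r.
Qed.

Lemma to_lem s t : (s <= t)%MM -> sigma s t.
Proof.
by move=> /submK <-; rewrite -[X in sigma X _]add0m; apply/to_add2r/to_0.
Qed.

Lemma slt_to_trans t s u : slt sigma s t -> sigma t u -> slt sigma s u.
Proof.
case/andP=> nst st tu; rewrite /slt (to_trans st tu) andbT.
by apply: contraNneq nst => su; rewrite (to_anti st) // su.
Qed.

Lemma sltNto s t : slt sigma s t -> ~~ sigma t s.
Proof. by case/andP=> nst st; apply: contra nst => /(to_anti st)->. Qed.

Lemma slt_addm s t u v :
  slt sigma s t -> sigma u v -> slt sigma (s + u)%MM (t + v)%MM.
Proof.
case/andP=> nst st uv; apply: (@slt_to_trans (t + u)%MM).
  rewrite /slt (to_add2r _ st) andbT; apply: contra nst => /eqP.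
  by rewrite ![(_ + u)%MM]addmC => /addmI->.
by apply: to_addm (to_refl t) uv.
Qed.

Lemma to_least (B : seq 'X_{1..n}) : B != [::] ->
  exists2 b, b \in B & forall b', b' \in B -> sigma b b'.
Proof.
elim: B => // b B IHB _.
have [->|/IHB[b1 b1B le_b1]] := eqVneq B [::].
  by exists b; rewrite ?inE // => b'; rewrite inE => /eqP->; apply: to_refl.
have [tot _ _ _ _] := to_sigma.
have [le_b|le_b] := orP (tot b b1).
  exists b; rewrite ?inE ?eqxx // => b'; rewrite inE => /orP[/eqP->|/le_b1].
    exact: to_refl.
  exact: to_trans.
exists b1; first by rewrite inE b1B orbT.
by move=> b'; rewrite inE => /orP[/eqP->|/le_b1].
Qed.

(** By [dickson], finitely many counterexamples divide all the others. Since [sigma] extends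
    divisibility, the [sigma]-least of these is a minimal counterexample, which contradicts the
    induction step. *)
Lemma to_ind (P : 'X_{1..n} -> Prop) :
  (forall t, (forall s, slt sigma s t -> P s) -> P t) -> forall t, P t.
Proof.
move=> IH t; apply: NNPP => nPt.
have [B BS SB] := dickson (fun s => ~ P s).
have [b0 b0B _] := SB t nPt.
have /to_least[b bB le_b] : B != [::] by apply: contraTneq b0B => ->.
apply: (BS b bB); apply: IH => s lt_sb; apply: NNPP => /SB[b' b'B le_b's].
by case/negP: (sltNto lt_sb); apply: to_trans (le_b b' b'B) (to_lem le_b's).
Qed.

(** * Leading terms, products and reduction steps *)

Section LeadingTerm.
Variable K : fieldType.
Implicit Types f g p q : {mpoly K[n]}.

Lemma LT_max f t : t \in msupp f -> sigma t (LT sigma f).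
Proof.
have [tot _ _ _ _] := to_sigma.
rewrite /LT; elim: (msupp f) => //= s r IHr.
rewrite inE => /orP[/eqP->|/IHr{}IHr].
  by case: ifP => // _; apply: to_refl.
case: ifPn => // /negPf.
by case/orP: (tot s (foldr (fun s t => if sigma s t then t else s) 0%MM r))
  => [->|/(to_trans IHr)].
Qed.

Lemma LT_msupp f : f != 0 -> LT sigma f \in msupp f.
Proof.
rewrite -msupp_eq0 => supp_f.
have : LT sigma f \in 0%MM :: msupp f.
  rewrite /LT; elim: (msupp f) => [|s r IHr]; first exact: mem_head.
  rewrite /=; case: ifP => _; last by rewrite !inE eqxx orbT.
  by move: IHr; rewrite !inE => /orP[]->; rewrite ?orbT.
(* If the fold returns its default [0%MM], every element of the support is at most 1, hence equal to
   1, so the default lies in the support after all. *)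
rewrite inE => /orP[/eqP LT0|//].
case: (msupp f) supp_f (@LT_max f) => // s r _ /(_ s (mem_head _ _)).
by rewrite LT0 => /to_anti -> //; rewrite ?mem_head //; apply: to_0.
Qed.

Lemma LT_unique f t :
  t \in msupp f -> (forall s, s \in msupp f -> sigma s t) -> LT sigma f = t.
Proof.
move=> tf le_t; apply: to_anti (LT_max tf); apply: le_t; apply: LT_msupp.
by apply: contraTneq tf => ->; rewrite msupp0.
Qed.

Lemma LC_neq0 f : f != 0 -> LC sigma f != 0.
Proof. by move/LT_msupp; rewrite mcoeff_msupp. Qed.

(** An upper bound that need not be attained: it also makes sense for 0 and passes to products
    without any nonvanishing condition. *)
Definition supp_below s p := forall t, t \in msupp p -> sigma t s.

Lemma supp_belowM s t p q :
  supp_below s p -> supp_below t q -> supp_below (s + t)%MM (p * q).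
Proof.
move=> ps qt u /msuppM_le /allpairsP[[u1 u2] [/= /ps ? /qt ? ->]].
exact: to_addm.
Qed.

Lemma supp_belowX s : supp_below s ('X_[s] : {mpoly K[n]}).
Proof. by move=> t; rewrite msuppX inE => /eqP->; apply: to_refl. Qed.

Lemma supp_belowZ s (a : K) p : supp_below s p -> supp_below s (a *: p).
Proof. by move=> ps t /msuppZ_le /ps. Qed.

Lemma supp_below_cancel s p q :
    supp_below s p -> supp_below s q -> p@_s = q@_s ->
  forall t, t \in msupp (p - q) -> slt sigma t s.
Proof.
move=> ps qs pq t tpq; rewrite /slt; apply/andP; split.
  by apply: contraTneq tpq => ->; rewrite mcoeff_msupp mcoeffB pq subrr eqxx.
by move/msuppB_le: tpq; rewrite mem_cat => /orP[/ps|/qs].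
Qed.

(** After the term of [p] at [s] is split off, the remaining terms are strictly below [s]; their
    products with terms of [q] stay strictly below [s + t]. *)
Lemma mcoeffM_below s t p q : supp_below s p -> supp_below t q ->
  (p * q)@_(s + t)%MM = p@_s * q@_t.
Proof.
move=> ps qt; rewrite -[in LHS](subrK (p@_s *: 'X_[s]) p) mulrDl mcoeffD.
rewrite -scalerAl mcoeffZ ['X_[s] * q]mulrC mcoeffMX.
rewrite memN_msupp_eq0 ?add0r //.
apply/negP=> /msuppM_le /allpairsP[[u1 u2] /= [u1p /qt le_u2 st]].
have lt_u1 : slt sigma u1 s.
  apply: supp_below_cancel u1p => //; first exact/supp_belowZ/supp_belowX.
  by rewrite mcoeffZ mcoeffX eqxx mulr1.
by have := slt_addm lt_u1 le_u2; rewrite /slt -st eqxx.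
Qed.

Lemma LT_below f s : supp_below s f -> f@_s != 0 -> LT sigma f = s.
Proof. by rewrite -mcoeff_msupp => fs sf; apply: LT_unique. Qed.

(** Well-founded induction on the leading term. The zero polynomial is separate because its [LT] is
    a junk value; bounding the support of [g] instead of its leading term lets a reduction end in
    0. *)
Lemma reduction_ind (P : {mpoly K[n]} -> Prop) : P 0 ->
    (forall f, f != 0 ->
       (forall g, (forall t, t \in msupp g -> slt sigma t (LT sigma f)) -> P g) ->
     P f) ->
  forall f, P f.
Proof.
move=> P0 IH f; have [->//|] := eqVneq f 0.
move: {2}(LT sigma f) (erefl (LT sigma f)) => t.
elim/to_ind: t f => t IHt f LTf f0.
apply: IH => // g lt_gf; have [->//|g0] := eqVneq g 0.
by apply: (IHt (LT sigma g)) => //; rewrite -LTf; apply/lt_gf/LT_msupp.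
Qed.

(** Builds the multiple of a monic divisor that [cancel_LT] subtracts in one division step. *)
Lemma supp_below_shift s t p : (t <= s)%MM -> supp_below t p -> p@_t = 1 ->
  supp_below s ('X_[s - t] * p) /\ ('X_[s - t] * p)@_s = 1.
Proof.
move=> /submK st pt p1; split.
  by rewrite -[X in supp_below X]st; apply: supp_belowM => //; apply: supp_belowX.
by rewrite -[X in _@_X]st mulrC mcoeffMX.
Qed.

Lemma cancel_LT f q : supp_below (LT sigma f) q -> q@_(LT sigma f) = 1 ->
  forall t, t \in msupp (f - LC sigma f *: q) -> slt sigma t (LT sigma f).
Proof.
move=> qf q1; apply: supp_below_cancel; first by move=> t; apply: LT_max.
  exact: supp_belowZ.
by rewrite mcoeffZ q1 mulr1.
Qed.

End LeadingTerm.
End TermOrdering.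

(** * Power products with and without the [i]-th indeterminate *)

Section Embedding.
Variables (n : nat) (i : 'I_n.+1).
Implicit Types (s t : 'X_{1..n}) (m : 'X_{1..n.+1}).

(** The effect on power products of setting the [i]-th indeterminate to 1; a left inverse of
    [emb i]. *)
Definition proj m : 'X_{1..n} := [multinom m (lift i k) | k < n].

Lemma emb_i t : emb i t i = 0%N.
Proof. by rewrite mnmE unlift_none. Qed.

Lemma emb_lift t k : emb i t (lift i k) = t k.
Proof. by rewrite mnmE liftK. Qed.

Lemma ord_liftP (P : 'I_n.+1 -> Prop) :
  P i -> (forall k, P (lift i k)) -> forall j, P j.
Proof. by move=> Pi Pl j; case: (unliftP i j) => [k ->|->]. Qed.

Lemma mnm_emb m : m = (U_(i) *+ m i + emb i (proj m))%MM.
Proof.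
apply/mnmP; apply: ord_liftP => [|k]; rewrite mnmDE mulmnE mnm1E.
  by rewrite eqxx emb_i mul1n addn0.
by rewrite (negPf (neq_lift i k)) emb_lift mnmE.
Qed.

Lemma emb_proj m : m i = 0%N -> emb i (proj m) = m.
Proof. by move=> mi; rewrite [RHS]mnm_emb mi mulm0n add0m. Qed.

Lemma emb_proj_lem m : (emb i (proj m) <= m)%MM.
Proof.
apply/mnm_lepP => j.
by rewrite (congr1 (fun u : 'X_{1..n.+1} => u j) (mnm_emb m)) mnmDE leq_addl.
Qed.

Lemma embK : cancel (emb i) proj.
Proof. by move=> t; apply/mnmP => k; rewrite mnmE emb_lift. Qed.

Lemma emb0 : emb i 0%MM = 0%MM.
Proof.
by apply/mnmP; apply: ord_liftP => [|k]; rewrite ?emb_i ?emb_lift !mnm0E.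
Qed.

Lemma embD s t : emb i (s + t)%MM = (emb i s + emb i t)%MM.
Proof.
by apply/mnmP; apply: ord_liftP => [|k]; rewrite mnmDE ?emb_i // !emb_lift mnmDE.
Qed.

Lemma embU k : emb i U_(k)%MM = U_(lift i k)%MM.
Proof.
apply/mnmP; apply: ord_liftP => [|k']; rewrite ?emb_i ?emb_lift !mnm1E.
  by rewrite eq_sym (negPf (neq_lift i k)).
by rewrite (inj_eq (@lift_inj _ i)).
Qed.

Lemma emb_lem s t : (emb i s <= emb i t)%MM = (s <= t)%MM.
Proof.
apply/mnm_lepP/mnm_lepP => [le_st k|le_st].
  by have := le_st (lift i k); rewrite !emb_lift.
by apply: ord_liftP => [|k]; rewrite ?emb_i ?emb_lift.
Qed.

Lemma hat_term_ordering (sigma : rel 'X_{1..n.+1}) :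
  term_ordering sigma -> term_ordering (hat_ordering i sigma).
Proof.
case=> tot anti tr add2r ge0; split=> [s t|s t st|t s u|s t u|t].
- exact: tot.
- exact/(can_inj embK)/anti.
- exact: tr.
- by rewrite /hat_ordering !embD; apply: add2r.
by rewrite /hat_ordering emb0; apply: ge0.
Qed.

End Embedding.

(** * The substitution homomorphism on monomials and on the linear form *)

Section Substitution.
Variables (K : fieldType) (n : nat) (i : 'I_n.+1).
Variables (c : 'I_n.+1 -> K) (gamma : K).
Local Notation pi := (piL i c gamma).
Local Notation L := (linL i c gamma).
Local Notation ell := (ell_hat i c gamma).

Lemma piLB f g : pi (f - g) = pi f - pi g.
Proof. exact: raddfB. Qed.

Lemma piLZ a f : pi (a *: f) = a *: pi f.
Proof. exact: linearZ. Qed.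

Lemma piLM f g : pi (f * g) = pi f * pi g.
Proof. exact: rmorphM. Qed.

Lemma piLX m : pi 'X_[m] = ell ^+ m i * 'X_[proj i m].
Proof.
rewrite /piL comp_mpolyX (bigD1_ord i) //= tnth_mktuple unlift_none.
congr (_ * _); rewrite mpolyXE_id; apply: eq_bigr => k _.
by rewrite tnth_mktuple liftK mnmE.
Qed.

Lemma piLX_emb t : pi 'X_[emb i t] = 'X_[t].
Proof. by rewrite piLX emb_i expr0 mul1r embK. Qed.

Lemma piLE f : pi f = \sum_(m <- msupp f) f@_m *: (ell ^+ m i * 'X_[proj i m]).
Proof. by rewrite /piL comp_mpolyEX; apply: eq_bigr => m _; rewrite -piLX. Qed.

Lemma piL_msupp f t : t \in msupp (pi f) ->
  exists2 m, m \in msupp f & t \in msupp (pi 'X_[m]).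
Proof.
move=> tf; apply/hasP; apply: contraTT tf => /hasPn tf.
rewrite mcoeff_msupp negbK piLE raddf_sum /= big_seq big1 // => m /tf.
by rewrite mcoeffZ piLX => /memN_msupp_eq0 ->; rewrite mulr0.
Qed.

Lemma piLU j : pi 'X_j = if unlift i j is Some k then 'X_k else ell.
Proof. by rewrite /piL comp_mpolyXU -tnth_nth tnth_mktuple. Qed.

Lemma piL_linL : pi L = 0.
Proof.
rewrite /linL piLB piLU unlift_none; apply/eqP; rewrite subr_eq0; apply/eqP.
rewrite /piL comp_mpolyD comp_mpolyC; congr (_ + _).
(* The index [i] itself fails the strict condition, so only the indices [lift i k] remain, as in
   [ell_hat]. *)
rewrite linear_sum /= [RHS]big_mkcond (bigD1_ord i) //= ltnn add0r.
rewrite [LHS]big_mkcond; apply: eq_bigr => k _.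
have := piLU (lift i k); rewrite /piL liftK => piUk.
by case: ifP => // _; rewrite comp_mpolyZ piUk.
Qed.

(** Applying [pi], which kills [L], to the hypothesis avoids extracting the vanishing of each
    coefficient [c j]. *)
Lemma ell_hat_const : L = 'X_i - gamma%:MP -> ell = gamma%:MP.
Proof.
move/(congr1 pi)/esym/eqP; rewrite piL_linL piLB piLU unlift_none.
by rewrite {1}/piL comp_mpolyC subr_eq0 => /eqP.
Qed.

(** For constant [ell], each power product is sent to a scalar multiple of a single power product,
    its projection. *)
Lemma msupp_piL_const f t : ell = gamma%:MP -> t \in msupp (pi f) ->
  exists2 m, m \in msupp f & proj i m = t.
Proof.
move=> ell_gamma /piL_msupp[m mf].
rewrite piLX ell_gamma -rmorphXn mul_mpolyC => /msuppZ_le.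
by rewrite msuppX inE => /eqP->; exists m.
Qed.

(** * Compatibility of the substitution with the term ordering *)

Section Ordering.
Variable sigma : rel 'X_{1..n.+1}.
Hypothesis to_sigma : term_ordering sigma.
Hypothesis sigma_decr : forall j k : 'I_n.+1,
  (j < k)%N -> slt sigma U_(k)%MM U_(j)%MM.
Local Notation hat_sigma := (hat_ordering i sigma).
Let to_hat := hat_term_ordering i to_sigma.

(** The number of indeterminates is arbitrary because the linear form is needed in both polynomial
    rings. *)
Lemma msupp_sum_linear (m : nat) (P : pred 'I_m) (a : 'I_m -> K) b t :
  t \in msupp (\sum_(j | P j) a j *: 'X_j + b%:MP : {mpoly K[m]}) ->
  t = 0%MM \/ exists2 j, P j & t = U_(j)%MM.
Proof.
rewrite mcoeff_msupp mcoeffD mcoeffC raddf_sum /=.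
have [->|t0] := eqVneq t 0%MM; first by left.
rewrite mulr0 addr0 => sum_neq0; right.
have [/existsP[j /andP[Pj /eqP->]]|no_j] :=
  boolP [exists j, P j && (t == U_(j)%MM)]; first by exists j.
case/eqP: sum_neq0; apply: big1 => j Pj; rewrite mcoeffZ mcoeffX.
by move/existsPn/(_ j): no_j; rewrite Pj eq_sym /= => /negPf->; rewrite mulr0.
Qed.

Lemma ell_below t : t \in msupp ell -> sigma (emb i t) U_(i)%MM.
Proof.
case/msupp_sum_linear => [->|[k lt_ik ->]].
  by rewrite emb0; apply: to_0.
by rewrite embU; case/andP: (sigma_decr lt_ik).
Qed.

Lemma linL_below : supp_below sigma U_(i)%MM L.
Proof.
move=> t /msuppB_le; rewrite mem_cat msuppX inE => /orP[/eqP->|].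
  exact: to_refl.
case/msupp_sum_linear => [->|[k lt_ik ->]]; first exact: to_0.
by case/andP: (sigma_decr lt_ik).
Qed.

Lemma mcoeff_linL : L@_U_(i) = 1.
Proof.
rewrite mcoeffB mcoeffX eqxx memN_msupp_eq0 ?subr0 //.
apply/negP => /msupp_sum_linear[/eqP|[k lt_ik /eqP]].
  by rewrite mnm1_eq0.
by rewrite eq_mnm1 => /eqP ik; rewrite ik ltnn in lt_ik.
Qed.

(** Each factor ['X_i] is replaced by terms no larger than it, so the substitution never raises a
    term; the induction is on the exponent of ['X_i]. *)
Lemma piLX_below m t : t \in msupp (pi 'X_[m]) -> sigma (emb i t) m.
Proof.
rewrite piLX => /msuppM_le /allpairsP[[t1 t2] /= [t1P + ->]].
rewrite msuppX inE => /eqP->; rewrite embD [X in sigma _ X](mnm_emb i m).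
apply: to_addm (to_refl to_sigma _) => //.
elim: (m i) t1 t1P => [|k IHk] t1.
  by rewrite expr0 msupp1 inE => /eqP->; rewrite emb0; apply: to_0.
rewrite exprS mulmS => /msuppM_le /allpairsP[[u1 u2] /= [u1P u2P ->]].
by rewrite embD; apply: to_addm (ell_below u1P) (IHk _ u2P).
Qed.

Lemma piL_below t f :
  supp_below sigma (emb i t) f -> supp_below hat_sigma t (pi f).
Proof.
move=> ft u /piL_msupp[m /ft le_mt /piLX_below le_um].
exact: (to_trans to_sigma le_um le_mt).
Qed.

(** The term at [emb i t] is free of ['X_i] and is mapped to the term at [t]. All other terms are
    strictly smaller, and by [piLX_below] their images cannot reach [t]. *)
Lemma mcoeff_piL t f :
  supp_below sigma (emb i t) f -> (pi f)@_t = f@_(emb i t).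
Proof.
move=> ft; set a := f@_(emb i t); apply/eqP; rewrite -subr_eq0.
have -> : (pi f)@_t - a = (pi (f - a *: 'X_[emb i t]))@_t.
  by rewrite piLB mcoeffB piLZ piLX_emb mcoeffZ mcoeffX eqxx mulr1.
apply/eqP/memN_msupp_eq0/negP => /piL_msupp[m mf /piLX_below].
apply/negP/sltNto => //; apply: supp_below_cancel mf => //.
  exact/supp_belowZ/supp_belowX.
by rewrite mcoeffZ mcoeffX eqxx mulr1.
Qed.

Lemma LT_piL t f : f != 0 -> LT sigma f = emb i t ->
  LT hat_sigma (pi f) = t /\ LC hat_sigma (pi f) = LC sigma f.
Proof.
move=> f0 LTf.
have ft : supp_below sigma (emb i t) f by rewrite -LTf => s; apply: LT_max.
have LTpi : LT hat_sigma (pi f) = t.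
  apply: LT_below => //; first exact: piL_below.
  by rewrite mcoeff_piL // -LTf; apply: LC_neq0.
by rewrite /LC LTpi LTf mcoeff_piL.
Qed.

(** * Gröbner bases under the substitution *)

Section Transfer.
Variables (I : {mpoly K[n.+1]} -> Prop) (G : {fset {mpoly K[n.+1]}}).
Hypotheses (idI : is_ideal I) (gbG : groebner_basis sigma G I).
Hypothesis monicG : monic_set sigma G.
(** The nonvanishing condition keeps the junk value of [LT] at 0 out of the equality of leading
    terms. *)
Hypothesis LTG : forall g, g \in G ->
  pi g != 0 /\ LT sigma g = emb i (LT hat_sigma (pi g)).

Let GI g : g \in G -> I g /\ g != 0.
Proof. by case: gbG => GI _; apply: GI. Qed.

Let LTG_i g : g \in G -> LT sigma g i = 0%N.
Proof. by case/LTG => _ ->; rewrite emb_i. Qed.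

Let LTG_below (g : {mpoly K[n.+1]}) : supp_below sigma (LT sigma g) g.
Proof. by move=> t; apply: LT_max. Qed.

Lemma LT_divisible f : I f -> f != 0 ->
  exists2 g, g \in G & (LT sigma g <= LT sigma f)%MM.
Proof. by case: gbG => GI' genG; apply/LTs_generateP: f. Qed.

Lemma linL_nonzerodivisor F : I (F * L) -> I F.
Proof.
elim/(reduction_ind to_sigma): F => [|F F0 IHF IFL]; first by case: idI.
set s := LT sigma F.
have FL_below : supp_below sigma (s + U_(i))%MM (F * L).
  by apply: supp_belowM linL_below => // t; apply: LT_max.
have FL_s : (F * L)@_(s + U_(i)) != 0.
  rewrite (mcoeffM_below to_sigma _ linL_below) => [|t]; last exact: LT_max.
  by rewrite mcoeff_linL mulr1 LC_neq0.
have FL0 : F * L != 0 by apply: contraNneq FL_s => ->; rewrite mcoeff0.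
have [g gG] := LT_divisible IFL FL0.
rewrite (LT_below to_sigma FL_below FL_s) => /mnm_lepP le_g.
(* The extra factor ['X_i] does not help [LT sigma g], whose exponent at [i] is 0. *)
have {}le_g : (LT sigma g <= s)%MM.
  apply/mnm_lepP; apply: (@ord_liftP _ i) => [|k]; first by rewrite LTG_i.
  by have := le_g (lift i k); rewrite mnmDE mnm1E (negPf (neq_lift i k)) addn0.
have [q_below q1] := supp_below_shift to_sigma le_g (@LTG_below g) (monicG gG).
set q := _ * g in q_below q1.
have Iq : I (LC sigma F *: q).
  by case: idI => _ _ IM; rewrite -mul_mpolyC mulrA; apply: IM; case: (GI gG).
(* The remainder has smaller terms, and its product with [L] is still in [I] because the subtracted
   multiple of [g] is. *)
rewrite -(subrK (LC sigma F *: q) F); case: (idI) => _ ID IM; apply: ID => //.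
apply: IHF; first exact: cancel_LT.
by rewrite mulrBl; apply: is_idealB => //; rewrite mulrC; apply: IM.
Qed.

Lemma LT_piL_divisible f : I f -> pi f != 0 ->
  exists2 g, g \in G & (LT hat_sigma (pi g) <= LT hat_sigma (pi f))%MM.
Proof.
elim/(reduction_ind to_sigma): f => [|f f0 IHf If pif0].
  by rewrite /piL comp_mpoly0 eqxx.
have [g gG le_g] := LT_divisible If f0.
have [_ LTg] := LTG gG.
have [f_i|f_i] := eqVneq (LT sigma f i) 0%N.
  have [LTpif _] := LT_piL f0 (esym (emb_proj f_i)).
  by exists g => //; rewrite LTpif -(emb_lem i) -LTg emb_proj.
(* [LT sigma g] and ['X_i] are coprime and both divide the leading term of [f], so their product
   divides it. *)
have {}le_g : (LT sigma g + U_(i) <= LT sigma f)%MM.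
  apply/mnm_lepP; apply: (@ord_liftP _ i) => [|k].
    by rewrite mnmDE LTG_i // mnm1E eqxx lt0n.
  by rewrite mnmDE mnm1E (negPf (neq_lift i k)) addn0; apply/mnm_lepP.
have gL_below := supp_belowM to_sigma (@LTG_below g) linL_below.
have gL1 : (g * L)@_(LT sigma g + U_(i)) = 1.
  rewrite (mcoeffM_below to_sigma (@LTG_below g) linL_below) mcoeff_linL mulr1.
  exact: monicG.
have [q_below q1] := supp_below_shift to_sigma le_g gL_below gL1.
set q := _ * (g * L) in q_below q1.
(* [q] is a multiple of [L], so subtracting it lowers [f] within [I] while fixing its image. *)
have pi_f : pi (f - LC sigma f *: q) = pi f.
  by rewrite piLB piLZ !piLM piL_linL !mulr0 scaler0 subr0.
rewrite -pi_f in pif0 *; apply: IHf => //; first exact: cancel_LT.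
apply: is_idealB => //; case: idI => _ _ IM; rewrite -mul_mpolyC.
by apply/IM/IM; rewrite mulrC; apply: IM; case: (GI gG).
Qed.

Lemma piL_setP h :
  reflect (exists2 g, g \in G & h = pi g) (h \in piL_set i c gamma G).
Proof. exact: imfsetP. Qed.

Let piG_I h : h \in piL_set i c gamma G -> piL_ideal i c gamma I h /\ h != 0.
Proof.
case/piL_setP => g gG ->; have [pig0 _] := LTG gG.
by split=> //; exists g => //; case: (GI gG).
Qed.

Lemma groebner_basis_piL :
  groebner_basis hat_sigma (piL_set i c gamma G) (piL_ideal i c gamma I).
Proof.
split=> //; apply/LTs_generateP => // _ [f If ->] pif0.
have [g gG le_g] := LT_piL_divisible If pif0.
by exists (pi g) => //; apply/piL_setP; exists g.
Qed.

(** If the image of [g] were redundant, the leading term of some other image [pi k] would divide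
    that of [pi g]. Through [emb i] the same divisibility holds between [k] and [g], making [g]
    redundant in [G]. *)
Lemma minimal_groebner_basis_piL : minimal_groebner_basis sigma G I ->
  minimal_groebner_basis hat_sigma (piL_set i c gamma G) (piL_ideal i c gamma I).
Proof.
case=> _ minG; split; first exact: groebner_basis_piL.
move=> _ /piL_setP[g gG ->] gen; apply: (minG g gG).
have piG'_I h : h \in (piL_set i c gamma G `\ pi g)%fset ->
  piL_ideal i c gamma I h /\ h != 0 by case/fsetD1P=> _; apply: piG_I.
have [||h /fsetD1P[hg /piL_setP[k kG def_h]]] :=
  (LTs_generateP hat_sigma piG'_I).1 gen (pi g); rewrite ?(LTG gG).1 //.
  by exists g => //; case: (GI gG).
have kg : k != g by apply: contraNneq hg => <-; rewrite def_h.
rewrite def_h -(emb_lem i) -(LTG kG).2 -(LTG gG).2 => le_kg.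
(* Wherever [g] served as divisor, [k] now replaces it. *)
apply/LTs_generateP => // [f /fsetD1P[_ /GI]//|f If f0].
have [g0 g0G le_g0] := LT_divisible If f0.
have [def_g0|g0g] := eqVneq g0 g; last by exists g0 => //; apply/fsetD1P.
exists k; first exact/fsetD1P.
by apply: lepm_trans le_kg _; rewrite -def_g0.
Qed.

(** The leading term of [g] is free of ['X_i], so [pi] commutes with removing it. A tail term of
    [pi g] is then the projection of a tail term [m] of [g], and a leading term dividing the
    projection would already divide [m]. *)
Lemma reduced_groebner_basis_piL :
  L = 'X_i - gamma%:MP -> reduced_groebner_basis sigma G I ->
  reduced_groebner_basis hat_sigma (piL_set i c gamma G) (piL_ideal i c gamma I).
Proof.
move=> /ell_hat_const ell_gamma [minG _ redG].
split; first exact: minimal_groebner_basis_piL.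
  move=> _ /piL_setP[g gG ->]; have [_ LTg] := LTG gG.
  by rewrite (LT_piL _ LTg).2 ?monicG //; case: (GI gG).
move=> _ _ t /piL_setP[g gG ->] /piL_setP[h hG ->].
rewrite -[X in _ - X]piLX_emb -(LTG gG).2 -piLB => /(msupp_piL_const ell_gamma).
case=> m /(redG g h m gG hG); rewrite (LTG hG).2 => le_hm <-.
apply: contra le_hm; rewrite -(emb_lem i) => /lepm_trans; apply.
exact: emb_proj_lem.
Qed.

End Transfer.
End Ordering.
End Substitution.

Theorem theorem1p7 (K : fieldType) (n : nat) (sigma : rel 'X_{1..n.+1})
    (hsigma : term_ordering sigma)
    (hdec : forall j k : 'I_n.+1, (j < k)%N -> slt sigma U_(k)%MM U_(j)%MM)
    (i : 'I_n.+1) (c : 'I_n.+1 -> K) (gamma : K)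
    (I : {mpoly K[n.+1]} -> Prop) (hI : is_ideal I)
    (G : {fset {mpoly K[n.+1]}})
    (hG : groebner_basis sigma G I) (hmonic : monic_set sigma G)
    (hLT : forall g, g \in G ->
       piL i c gamma g != 0 /\
       LT sigma g = emb i (LT (hat_ordering i sigma) (piL i c gamma g))) :
  (* (a) *)
  [/\ forall F, I (F * linL i c gamma) -> I F,
  (* (b) *)
      groebner_basis (hat_ordering i sigma) (piL_set i c gamma G)
        (piL_ideal i c gamma I),
  (* (c) *)
      minimal_groebner_basis sigma G I ->
      minimal_groebner_basis (hat_ordering i sigma) (piL_set i c gamma G)
        (piL_ideal i c gamma I)
  (* (d) *)
    & linL i c gamma = 'X_i - gamma%:MP ->
      reduced_groebner_basis sigma G I ->
      reduced_groebner_basis (hat_ordering i sigma) (piL_set i c gamma G)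
        (piL_ideal i c gamma I)].
Proof.
split.
- exact: (linL_nonzerodivisor hsigma hdec hI hG hmonic hLT).
- exact: (groebner_basis_piL hsigma hdec hI hG hmonic hLT).
- exact: (minimal_groebner_basis_piL hsigma hdec hI hG hmonic hLT).
exact: (reduced_groebner_basis_piL hsigma hdec hI hG hmonic hLT).
Qed.
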